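(* Let $\alpha_1,\alpha_2\in\mathbb{C}\setminus\mathbb{R}_0^+$ with $|\alpha_1|=|\alpha_2|=1$, $\alpha_1\neq\alpha_2$ and $\alpha_2\neq\overline{\alpha}_1$. Let $c_1,c_2$ be nonzero complex numbers and define \[ b(n):=c_1\alpha_1^n+\overline{c}_1\overline{\alpha}_1^n+c_2\alpha_2^n+\overline{c}_2\overline{\alpha}_2^n,\qquad n\ge 0. \] Then there is $\delta>0$ such that $b(n)>\delta$ for infinitely many $n$ and $b(n)<-\delta$ for infinitely many $n$.
   Context: $\mathbb{R}_0^+$ denotes the set of non-negative real numbers; $\overline{z}$ denotes complex conjugation. *)

(* Defs.v *)
From HB Require Import structures.
From mathcomp Require Import all_boot all_order all_algebra.
From mathcomp Require Import boolp classical_sets cardinality reals.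
From mathcomp Require Import complex.

Set Implicit Arguments.
Unset Strict Implicit.
Unset Printing Implicit Defensive.

Import Order.TTheory GRing.Theory Num.Theory.
Local Open Scope ring_scope.
Local Open Scope complex_scope.

(* The complex numbers are R[i] over an arbitrary realType R; z^* is [conjc].
   The values are kept in R[i], although they are all real. *)
Definition b (R : realType) (c1 c2 alpha1 alpha2 : R[i]) (n : nat) : R[i] :=
  c1 * alpha1 ^+ n + c1^* * alpha1^* ^+ n
  + c2 * alpha2 ^+ n + c2^* * alpha2^* ^+ n.

(* Main.v *)
(* None of the four frequencies equals 1, so the partial sums of b are bounded.
   One of alpha1, alpha2, say alpha1, is not real (otherwise both are -1), so in
   b n * alpha1^* ^+ n only the constant term c1 fails to have bounded partial
   sums.  Hence the partial sums of |b| grow at least at the linear rate |c1|,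
   and, the sums of b being bounded, the positive and the negative part of b
   each account for half of this growth. *)
Require Import Defs.
From HB Require Import structures.
From mathcomp Require Import all_boot all_order all_algebra.
From mathcomp Require Import boolp classical_sets cardinality reals.
From mathcomp Require Import complex.
From mathcomp Require Import ring lra.

Set Implicit Arguments.
Unset Strict Implicit.
Unset Printing Implicit Defensive.

Import Order.TTheory GRing.Theory Num.Theory.
Local Open Scope classical_set_scope.
Local Open Scope ring_scope.

Lemma finite_set_nat_bounded (A : set nat) :
  finite_set A -> exists M, forall n, (M <= n)%N -> ~ A n.
Proof.
move=> /finite_seqP[s ->]; exists (\max_(i <- s) i).+1 => n ltMn /= sn.
by have := @leq_bigmax_seq nat s xpredT id n sn isT; rewrite leqNgt ltMn.
Qed.

(* If f <= eps / 4 from M on, then the partial sums of `|f| + f = 2 max(f, 0)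
   grow at most at rate eps / 2, whereas the hypotheses force rate eps. *)
Lemma infinite_gt_of_sum_norm (R : realType) (f : nat -> R) (eps K : R) :
    0 < eps -> (forall N, - K <= \sum_(n < N) f n) ->
    (forall N, eps * N%:R - K <= \sum_(n < N) `|f n|) ->
  infinite_set [set n | eps / 4 < f n].
Proof.
move=> eps0 sumf sum_norm /finite_set_nat_bounded[M leM].
pose g n := `|f n| + f n; pose A := \sum_(n < M) g n.
have sumg k : \sum_(n < M + k) g n <= A + eps / 2 * k%:R.
  elim: k => [|k IHk]; first by rewrite addn0 mulr0 addr0.
  rewrite addnS big_ord_recr /= -[k.+1%:R]natr1 mulrDr mulr1 (addrA A) lerD //.
  have /leM/negP := leq_addr k M; rewrite -leNgt /g.
  by case: ger0P => _; lra.
(* By the Archimedean property [k] makes [eps / 2 * k] exceed [A + 2 * K]. At [M + k] the hypotheses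
   and [sumg] give [eps * (M + k) - 2 * K <= A + eps / 2 * k], a contradiction. *)
pose k := Num.bound (`|A + 2 * K| / (eps / 2)).
have : A + 2 * K < eps / 2 * k%:R.
  rewrite (le_lt_trans (ler_norm _)) // [ltRHS]mulrC -ltr_pdivrMr; last by lra.
  by apply: archi_boundP; apply: divr_ge0 => //; lra.
have := sumg k; rewrite big_split /=.
have := sumf (M + k)%N; have := sum_norm (M + k)%N; rewrite natrD.
have : 0 <= eps * M%:R by rewrite mulr_ge0 ?ler0n ?ltW.
lra.
Qed.

(** The bound [K] lives in [C]; lying above a norm, it is automatically real and non-negative. *)
Definition bounded_sums (C : numFieldType) (g : nat -> C) :=
  exists K, forall N, `|\sum_(n < N) g n| <= K.

Lemma eq_bounded_sums (C : numFieldType) (g h : nat -> C) :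
  g =1 h -> bounded_sums g -> bounded_sums h.
Proof. by move=> /funext ->. Qed.

Lemma bounded_sumsD (C : numFieldType) (g h : nat -> C) :
  bounded_sums g -> bounded_sums h -> bounded_sums (fun n => g n + h n).
Proof.
move=> [K gK] [L hL]; exists (K + L) => N; rewrite big_split /=.
exact: le_trans (ler_normD _ _) (lerD (gK N) (hL N)).
Qed.

(** Multiplied by [z - 1], the sum of the powers of [z] collapses to [z ^+ N - 1], of norm at most
    2. *)
Lemma bounded_sums_geometric (C : numFieldType) (c z : C) :
  `|z| = 1 -> z != 1 -> bounded_sums (fun n => c * z ^+ n).
Proof.
move=> z1 neqz1; exists (`|c| * (2 / `|z - 1|)) => N.
have z10 : z - 1 != 0 by rewrite subr_eq0.
rewrite -big_distrr /= normrM ler_wpM2l // ler_pdivlMr ?normr_gt0 //.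
rewrite -normrM mulrC -subrX1 (le_trans (ler_normB _ _)) //.
by rewrite normrX z1 expr1n normr1.
Qed.

Lemma conj_norm1 (C : numClosedFieldType) (z : C) : `|z| = 1 -> z^* = z^-1.
Proof. by move=> z1; rewrite invC_norm z1 expr1n invr1 mul1r. Qed.

Section TwoFrequencies.

Variables (C : numClosedFieldType) (c1 c2 alpha1 alpha2 : C).
Hypotheses (norm1 : `|alpha1| = 1) (norm2 : `|alpha2| = 1).

(** This is [b] written with the conjugation of a generic [numClosedFieldType]; over [R[i]] the two
    are convertible, so the lemmas below apply to [b] as they stand. *)
Let d (n : nat) : C := c1 * alpha1 ^+ n + c1^* * alpha1^* ^+ n
  + c2 * alpha2 ^+ n + c2^* * alpha2^* ^+ n.

Lemma real_d n : d n \is Num.real.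
Proof.
rewrite CrealE /d !rmorphD !rmorphM !rmorphXn /= !conjCK.
by apply/eqP; ring.
Qed.

Lemma bounded_sums_d :
  alpha1 != 1 -> alpha2 != 1 -> bounded_sums d.
Proof.
move=> neq1 neq2.
have conj_neq1 (z : C) : z != 1 -> z^* != 1.
  by apply: contra_neq => zJ; rewrite -[z]conjCK zJ conjC1.
rewrite /d; do !apply: bounded_sumsD; apply: bounded_sums_geometric;
  by rewrite ?norm_conjC ?conj_neq1.
Qed.

(** As [alpha1^*] is the inverse of [alpha1], the twist turns the frequency [alpha1] into 1, and
    subtracting [c1] cancels that term. Each of the three disequalities keeps one of the remaining
    frequencies away from 1. *)
Lemma bounded_sums_twist :
    alpha1 != alpha1^* -> alpha1 != alpha2 -> alpha2 != alpha1^* ->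
  bounded_sums (fun n => d n * alpha1^* ^+ n - c1).
Proof.
move=> nreal1 neq12 neq12c.
have nz1 : alpha1 != 0 by rewrite -normr_eq0 norm1 oner_neq0.
have twist_neq1 (z : C) : z != alpha1 -> z * alpha1^* != 1.
  by rewrite conj_norm1 //; apply: contra_neq => /divr1_eq.
apply: (@eq_bounded_sums _ (fun n => c1^* * (alpha1^* * alpha1^*) ^+ n
    + c2 * (alpha2 * alpha1^*) ^+ n + c2^* * (alpha2^* * alpha1^*) ^+ n)).
  move=> n; rewrite /d !exprMn.
  have : alpha1 ^+ n * alpha1^* ^+ n = 1.
    by rewrite -exprMn conj_norm1 // mulfV // expr1n.
  by move=> e; ring: e.
do !apply: bounded_sumsD; apply: bounded_sums_geometric;
  rewrite ?normrM ?norm_conjC ?norm1 ?norm2 ?mulr1 //; apply: twist_neq1.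
- by rewrite eq_sym.
- by rewrite eq_sym.
- by apply: contra_neq neq12c => <-; rewrite conjCK.
Qed.

End TwoFrequencies.

Local Open Scope complex_scope.

(** The case where [alpha1] is the non-real frequency; the other case follows by exchanging the
    indices. *)
Lemma infinite_b_gt_lt (R : realType) (c1 c2 alpha1 alpha2 : R[i]) :
    `|alpha1| = 1 -> `|alpha2| = 1 ->
    alpha1 != 1 -> alpha2 != 1 -> alpha1 != alpha1^* ->
    alpha1 != alpha2 -> alpha2 != alpha1^* -> c1 != 0 ->
  exists delta : R, [/\ 0 < delta,
    infinite_set [set n : nat | delta%:C < b c1 c2 alpha1 alpha2 n] &
    infinite_set [set n : nat | b c1 c2 alpha1 alpha2 n < (- delta)%:C]].
Proof.
move=> norm1 norm2 neq1 neq2 nreal1 neq12 neq12c nz1.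
have [K sumK] := @bounded_sums_d _ c1 c2 _ _ norm1 norm2 neq1 neq2.
have [L sumL] := @bounded_sums_twist _ c1 c2 _ _ norm1 norm2 nreal1 neq12 neq12c.
pose f n := complex.Re (b c1 c2 alpha1 alpha2 n).
have bE n : b c1 c2 alpha1 alpha2 n = (f n)%:C by rewrite /f RRe_real // real_d.
have norm_real (x : R) : `|x%:C| = `|x|%:C.
  by rewrite normc_def /= expr0n addr0 sqrtr_sqr.
have Re_real (x : R[i]) : 0 <= x -> (complex.Re x)%:C = x.
  by move=> /ger0_real/RRe_real.
have [eps0 epsE] : 0 < complex.Re `|c1| /\ (complex.Re `|c1|)%:C = `|c1|.
  by rewrite -ltcR Re_real ?normr_gt0.
set eps := complex.Re `|c1| in eps0 epsE.
have K0 : 0 <= K by exact: le_trans (sumK 0%N).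
have L0 : 0 <= L by exact: le_trans (sumL 0%N).
(* A single real constant dominating both bounds, to serve as the [K] of
   [infinite_gt_of_sum_norm]. *)
pose B := complex.Re (K + L).
have BE : B%:C = K + L by rewrite Re_real ?addr_ge0.
have sumf N : `|\sum_(n < N) f n| <= B.
  have sumE : (\sum_(n < N) f n)%:C = \sum_(n < N) b c1 c2 alpha1 alpha2 n.
    by rewrite rmorph_sum; apply: eq_bigr => n _; rewrite bE.
  rewrite -lecR -norm_real sumE BE.
  by rewrite (le_trans (sumK N)) // lerDl.
have sum_norm N : eps * N%:R - B <= \sum_(n < N) `|f n|.
  have sumE : (\sum_(n < N) `|f n|)%:C = \sum_(n < N) `|b c1 c2 alpha1 alpha2 n|.
    by rewrite rmorph_sum; apply: eq_bigr => n _; rewrite bE norm_real.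
  rewrite -lecR sumE rmorphB rmorphM rmorph_nat /= BE epsE.
  rewrite lerBlDr (@le_trans _ _ (\sum_(n < N) `|b c1 c2 alpha1 alpha2 n| + L)) //;
    last by rewrite lerD2l lerDr.
  have -> : `|c1| * N%:R = `|\sum_(n < N) c1|.
    by rewrite sumr_const card_ord normrMn mulr_natr.
  (* The first sum has norm at most the sum of the norms of [b], since [alpha1^* ^+ n] has norm 1;
     the second is bounded by [L]. *)
  have -> : \sum_(n < N) c1 = \sum_(n < N) b c1 c2 alpha1 alpha2 n * alpha1^* ^+ n
      - \sum_(n < N) (b c1 c2 alpha1 alpha2 n * alpha1^* ^+ n - c1).
    by rewrite -sumrB; apply: eq_bigr => n _; ring.
  apply: le_trans (ler_normB _ _) (lerD _ (sumL N)).
  apply: le_trans (ler_norm_sum _ _ _) _; apply: ler_sum => n _.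
  by rewrite normrM normrX norm_conjC norm1 expr1n mulr1.
exists (eps / 4); split; first by lra.
- have : infinite_set [set n | eps / 4 < f n].
    apply: (@infinite_gt_of_sum_norm _ _ _ B) => // N.
    by have /ler_normlP[] := sumf N; lra.
  by under eq_set do rewrite -ltcR -bE.
(* The same lemma for [- f]: the norms are unchanged, and the upper bound on the sums of [f] becomes
   the lower one. *)
- have : infinite_set [set n | eps / 4 < - f n].
    apply: (@infinite_gt_of_sum_norm _ _ _ B) => // N.
      by rewrite sumrN lerN2; have /ler_normlP[] := sumf N.
    by under eq_bigr do rewrite normrN.
  by under eq_set do rewrite ltrNr -ltcR -bE.
Qed.

(* In the order of R[i], x < y means that y - x is real and positive, so
   alpha \isn't Num.nneg says that alpha is not a non-negative real, and
   delta%:C < b n says that b n is a real number greater than delta. *)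
Theorem theorem2p1 (R : realType) (alpha1 alpha2 c1 c2 : R[i])
  (halpha1 : alpha1 \isn't Num.nneg) (halpha2 : alpha2 \isn't Num.nneg)
  (norm1 : `|alpha1| = 1) (norm2 : `|alpha2| = 1)
  (neq12 : alpha1 <> alpha2) (neq12c : alpha2 <> alpha1^*)
  (hc1 : c1 <> 0) (hc2 : c2 <> 0) :
  exists delta : R, [/\ 0 < delta,
    infinite_set [set n : nat | delta%:C < b c1 c2 alpha1 alpha2 n] &
    infinite_set [set n : nat | b c1 c2 alpha1 alpha2 n < (- delta)%:C]].
Proof.
have neq1 (z : R[i]) : z \isn't Num.nneg -> z != 1.
  by apply: contraNneq => ->; rewrite nnegrE ler01.
have real_N1 (z : R[i]) : z \isn't Num.nneg -> `|z| = 1 -> z = z^* -> z = -1.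
  move=> zneg z1 zJ; have : z \is Num.real by rewrite CrealE; apply/eqP.
  move: zneg; rewrite realE nnegrE => /negPf-> /= /ler0_norm.
  by rewrite z1 => ->; rewrite opprK.
case: (eqVneq alpha1 alpha1^*) => [real1|nreal1]; last first.
  by apply: infinite_b_gt_lt => //; [exact: neq1|exact: neq1| | |]; apply/eqP.
(* If [alpha2] were real as well, both frequencies would be -1, hence equal. *)
have nreal2 : alpha2 != alpha2^*.
  by apply/eqP => real2; apply: neq12; rewrite (real_N1 _ halpha1) // (real_N1 _ halpha2).
have [||||||delta [delta0 gtd ltd]] := @infinite_b_gt_lt _ c2 c1 _ _ norm2 norm1.
- exact: neq1.
- exact: neq1.
- exact: nreal2.
- by apply/eqP => /esym.
- by apply/eqP => real1c; apply: neq12c; rewrite real1c; exact/esym/conjcK.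
- exact/eqP.
have bC n : b c2 c1 alpha2 alpha1 n = b c1 c2 alpha1 alpha2 n.
  by rewrite /b; ring.
exists delta; split=> //; first by under eq_set do rewrite -bC.
by under eq_set do rewrite -bC.
Qed.
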